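(* For every $k\in\mathbb{N}$, $\mathcal{S}_{\mathcal{M}_k}$ is closed under intersection: for every tournament $T$ and all $B,C\in\mathcal{S}_{\mathcal{M}_k}(T)$, $B\cap C\in\mathcal{S}_{\mathcal{M}_k}(T)$.
   Context: Let $X$ be a universe of alternatives. A tournament $T=(A,\succ)$: $A$ a non-empty finite subset of $X$, $\succ$ an asymmetric complete relation on $X$. For $B\subseteq A$ write $B$ also for $(B,\succ)$; $\max_\prec(B)=\{a\in B:\text{no }b\in B\text{ with }b\succ a\}$. $\mathcal{M}(T)=\{B\subseteq A:\max_\prec(B)\neq\emptyset\}$ and $\mathcal{M}_k(T)=\{B\in\mathcal{M}(T):|B|\le k\}$. $S_{\mathcal{M}_k}(T)=\bigcup\{\max_\prec(B): B\text{ an inclusion-maximal element of }\mathcal{M}_k(T)\}$ (a tournament solution). For a tournament solution $S$, $B\subseteq A$ is (externally) $S$-stable in $T$ if $a\notin S(B\cup\{a\})$ for all $a\in A\setminus B$; $\mathcal{S}_{\mathcal{M}_k}(T)$ denotes the set of $S_{\mathcal{M}_k}$-stable sets of $T$. *)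

(* Defs.v *)
From HB Require Import structures.
From mathcomp Require Import all_boot all_order.
From mathcomp Require Import finmap.

Set Implicit Arguments.
Unset Strict Implicit.
Unset Printing Implicit Defensive.

Local Open Scope fset_scope.

(* The dominance relation lives on the whole universe X, so that a subset of
   the alternatives is again a tournament with the same relation.  The
   asymmetry axiom makes the relation irreflexive. *)
Record tournament (X : choiceType) := Tournament {
  alts : {fset X};
  dom : rel X;
  alts_neq0 : alts != fset0;
  dom_asym : forall x y : X, dom x y -> ~~ dom y x;
  dom_complete : forall x y : X, x != y -> dom x y || dom y x
}.

Definition restrict (X : choiceType) (T : tournament X) (B : {fset X})
    (B_neq0 : B != fset0) : tournament X :=
  Tournament B_neq0 (@dom_asym X T) (@dom_complete X T).

Lemma fset1U_neq0 (X : choiceType) (a : X) (B : {fset X}) :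
  a |` B != fset0.
Proof. by apply/fset0Pn; exists a; rewrite in_fset1U eqxx. Qed.

Definition max_alts (X : choiceType) (T : tournament X) (B : {fset X}) :
    {fset X} :=
  [fset a in B | [forall b : B, ~~ dom T (val b) a]].

Definition has_max_sets (X : choiceType) (T : tournament X) :
    {fset {fset X}} :=
  [fset B in fpowerset (alts T) | max_alts T B != fset0].

Definition has_max_sets_le (X : choiceType) (k : nat) (T : tournament X) :
    {fset {fset X}} :=
  [fset B in has_max_sets T | #|` B| <= k].

Definition inclusion_maximal (X : choiceType) (Q : {fset {fset X}}) :
    {fset {fset X}} :=
  [fset B in Q | [forall C : Q, ~~ (B `<` val C)]].

Definition sol_Mk (X : choiceType) (k : nat) (T : tournament X) : {fset X} :=
  \bigcup_(B <- inclusion_maximal (has_max_sets_le k T)) max_alts T B.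

Definition stable_sets (X : choiceType) (S : tournament X -> {fset X})
    (T : tournament X) : {fset {fset X}} :=
  [fset B in fpowerset (alts T) |
    [forall a : alts T `\` B,
      val a \notin S (restrict T (fset1U_neq0 (val a) B))]].

(* Main.v *)
(* The solution S_{M_(k+1)} discards an alternative a exactly when a dominates
   fewer than k alternatives and is covered.  If a lies outside B, its cover in
   B lies in C or is covered in C; that cover lies in B or is covered in B, and
   so on.  Every member of this chain dominates all the earlier ones, so the
   chain stops, and it can only stop in the intersection of B and C, at an
   alternative that covers a relative to this intersection. *)
Require Import Defs.
From HB Require Import structures.
From mathcomp Require Import all_boot all_order.
From mathcomp Require Import finmap.

Set Implicit Arguments.
Unset Strict Implicit.
Unset Printing Implicit Defensive.

Local Open Scope fset_scope.

Lemma fsubset_card_ex (K : choiceType) (D : {fset K}) (k : nat) :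
  k <= #|` D| -> exists2 E : {fset K}, E `<=` D & #|` E| = k.
Proof.
move=> le_kD; exists [fset x in take k D].
  by apply/fsubsetP=> x; rewrite inE /= => /mem_take.
rewrite card_fseq undup_id ?take_uniq ?fset_uniq //.
by rewrite size_take_min; apply/minn_idPl.
Qed.

Section Covering.

Variable X : choiceType.
Implicit Types (T : tournament X) (B C Y : {fset X}) (a b : X).

Lemma dom_irr T a : dom T a a = false.
Proof. by apply/negP=> daa; move: (dom_asym daa); rewrite daa. Qed.

Lemma dom_neq T a b : a != b -> ~~ dom T a b -> dom T b a.
Proof. by move=> neq_ab /negPf nd; move: (dom_complete T neq_ab); rewrite nd. Qed.

Lemma max_altsP T B a :
  reflect (a \in B /\ forall b, b \in B -> ~~ dom T b a) (a \in max_alts T B).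
Proof.
rewrite /max_alts !inE /=; apply: (iffP andP) => -[aB maxa]; split=> //.
  by move=> b bB; apply: (forallP maxa [` bB]).
by apply/forallP=> b; apply: maxa; apply: valP.
Qed.

Lemma has_max_sets_leP k T B :
  reflect [/\ B `<=` alts T, exists a, a \in max_alts T B & #|` B| <= k]
    (B \in has_max_sets_le k T).
Proof.
rewrite /has_max_sets_le /has_max_sets !inE /= fpowersetE.
by apply: (iffP andP) => [[/andP[sB /fset0Pn m] le_Bk]|[sB /fset0Pn m le_Bk]];
  split=> //; apply/andP.
Qed.

Lemma inclusion_maximalP (Q : {fset {fset X}}) B :
  reflect (B \in Q /\ forall C, C \in Q -> ~~ (B `<` C))
    (B \in inclusion_maximal Q).
Proof.
rewrite /inclusion_maximal !inE /=; apply: (iffP andP) => -[BQ maxB]; split=> //.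
  by move=> C CQ; apply: (forallP maxB [` CQ]).
by apply/forallP=> C; apply: maxB; apply: valP.
Qed.

Lemma sol_MkP k T a :
  reflect (exists2 B, B \in inclusion_maximal (has_max_sets_le k T)
                    & a \in max_alts T B)
    (a \in sol_Mk k T).
Proof.
apply: (iffP (bigfcupP _ _ _ _)) => [[B /andP[Bmax _] aB]|[B Bmax aB]]; exists B => //.
by rewrite Bmax.
Qed.

Definition dominion T a := [fset b in alts T | dom T a b].

(** The usual covering relation, with [b] above [a], except that [a] may lie outside [B]: stability
    of [B] concerns precisely such alternatives. *)
Definition covers T B a b :=
  [/\ b \in B, dom T b a & forall d, d \in B -> dom T a d -> dom T b d].

Lemma max_alts_fset1U T a B :
  (forall b, b \in B -> dom T a b) -> a \in max_alts T (a |` B).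
Proof.
move=> aB; apply/max_altsP; split=> [|b]; first exact: fset1U1.
by case/fset1UP=> [->|/aB/dom_asym //]; rewrite dom_irr.
Qed.

Lemma mem_dominion T a b : (b \in dominion T a) = (b \in alts T) && dom T a b.
Proof. by rewrite !inE. Qed.

Lemma notin_dominion T a : a \notin dominion T a.
Proof. by rewrite mem_dominion dom_irr andbF. Qed.

(** Completeness turns undominated into dominating. Together with [max_alts_fset1U], this describes
    the sets in which [a] is maximal as [a] with part of its dominion. *)
Lemma max_alts_subset T B a :
  B `<=` alts T -> a \in max_alts T B -> B `<=` a |` dominion T a.
Proof.
move=> /fsubsetP sB /max_altsP[aB maxa]; apply/fsubsetP=> b bB.
rewrite in_fset1U mem_dominion; case: eqVneq => //= neq_ba.
by rewrite sB //= (dom_neq neq_ba) ?maxa.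
Qed.

(** If [a] dominates at least [k] alternatives, [a] with [k] of them fills the size bound and is
    inclusion-maximal. Otherwise the only candidate is [a] with its whole dominion, and it can be
    enlarged exactly when some [b] dominates all of it, that is, covers [a]. *)
Lemma notin_sol_Mk k T a : a \in alts T ->
  a \notin sol_Mk k.+1 T <->
  #|` dominion T a| < k /\ exists b, covers T (alts T) a b.
Proof.
move=> aT.
have sub_aD E : E `<=` dominion T a ->
    a |` E `<=` alts T /\ a \in max_alts T (a |` E).
  move=> /fsubsetP sED; split.
    by apply/fsubsetP=> b /fset1UP[->//|/sED]; rewrite mem_dominion => /andP[].
  by apply: max_alts_fset1U => b /sED; rewrite mem_dominion => /andP[].
split=> [nSa|[lt_Dk [b [bT dba cov]]]].
  have lt_Dk : #|` dominion T a| < k.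
    rewrite ltnNge; apply/negP=> /fsubset_card_ex[E sED cardE].
    have [saE maxa] := sub_aD E sED.
    have aE : a \notin E by apply: contra (notin_dominion T a); apply/fsubsetP.
    have card_aE : #|` a |` E| = k.+1 by rewrite cardfsU1 aE cardE.
    case/sol_MkP: nSa; exists (a |` E) => //; apply/inclusion_maximalP; split.
      by apply/has_max_sets_leP; split; [|exists a|rewrite card_aE].
    move=> C /has_max_sets_leP[_ _ le_Ck]; apply/negP=> /fproper_ltn_card.
    by rewrite card_aE ltnNge le_Ck.
  split=> //; have [saD maxa] := sub_aD _ (fsubset_refl _).
  have MaD : a |` dominion T a \in has_max_sets_le k.+1 T.
    apply/has_max_sets_leP; split=> //; first by exists a.
    by rewrite cardfsU1 notin_dominion ltnW.
  have : ~~ [forall C : has_max_sets_le k.+1 T,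
      ~~ (a |` dominion T a `<` val C)].
    apply: contra nSa => /forallP m; apply/sol_MkP; exists (a |` dominion T a) => //.
    by apply/inclusion_maximalP; split=> // C CM; apply: (m [` CM]).
  case/forallPn=> -[C CM] /=.
  rewrite negbK fproperE => /andP[/fsubsetP saDC /fsubsetPn[c cC ncaD]].
  have /has_max_sets_leP[sC [b maxb] _] := CM.
  (* If [b] were [a], then [C] would be contained in [a] with its dominion, against the choice of
     [c]. *)
  have neq_ab : a != b.
    apply: contraNneq ncaD => eq_ab; rewrite eq_ab in maxb *.
    exact: (fsubsetP (max_alts_subset sC maxb)).
  have /max_altsP[bC maxb'] := maxb.
  have dba : dom T b a.
    by apply: dom_neq neq_ab _; apply: maxb'; apply: saDC; apply: fset1U1.
  exists b; split=> //; first exact: (fsubsetP sC).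
  move=> d dT dad; apply: (dom_neq (a := d)).
    by apply: contraTneq dad => ->; apply: dom_asym.
  by apply: maxb'; apply: saDC; rewrite in_fset1U mem_dominion dT dad orbT.
apply/sol_MkP=> -[B /inclusion_maximalP[/has_max_sets_leP[sB _ _] maxB] maxa].
have sBD := max_alts_subset sB maxa.
have /max_altsP[aB maxa'] := maxa.
have bB : b \notin B by apply: contraL dba; apply: maxa'.
(* The cover [b] dominates all of [B], and the strict bound on the dominion leaves room for one more
   element. *)
have /maxB/negP[] : b |` B \in has_max_sets_le k.+1 T; last first.
  by rewrite fproperE fsubsetU1 fsubUset fsub1set (negPf bB).
apply/has_max_sets_leP; split.
- by apply/fsubsetP=> x /fset1UP[->//|/(fsubsetP sB)].
- exists b; apply: max_alts_fset1U => d /(fsubsetP sBD) /fset1UP[->//|].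
  by rewrite mem_dominion => /andP[]; apply: cov.
rewrite cardfsU1 bB add1n ltnS.
apply: leq_trans (fsubset_leq_card sBD) _.
by rewrite cardfsU1 notin_dominion.
Qed.

(** The bound 0, not reached by [notin_sol_Mk], allows only the empty set, which has no maximal
    alternative. *)
Lemma sol_M0 T : sol_Mk 0 T = fset0.
Proof.
apply/fsetP=> a; rewrite in_fset0; apply/sol_MkP.
case=> B /inclusion_maximalP[/has_max_sets_leP[_ _]].
by rewrite leqn0 cardfs_eq0 => /eqP-> _ /max_altsP[].
Qed.

Lemma stable_setsP S T B :
  reflect (B `<=` alts T /\ forall a, a \in alts T -> a \notin B ->
             a \notin S (restrict T (fset1U_neq0 a B)))
    (B \in stable_sets S T).
Proof.
rewrite /stable_sets !inE /= fpowersetE; apply: (iffP andP) => -[sB st]; split=> //.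
  move=> a aT aB; have aTB : a \in alts T `\` B by rewrite in_fsetD aB.
  exact: (forallP st [` aTB]).
apply/forallP=> a; have := valP a; rewrite in_fsetD => /andP[aB aT]; exact: st.
Qed.

(** No alternative dominates itself, so adding [a] to [B] affects neither the dominion of [a] nor
    its covers, and stability is expressed in terms of [B] alone. *)
Lemma notin_sol_restrict k T B a :
  a \notin B ->
  a \notin sol_Mk k.+1 (restrict T (fset1U_neq0 a B)) <->
  #|` [fset b in B | dom T a b]| < k /\ exists b, covers T B a b.
Proof.
move=> aB; rewrite notin_sol_Mk /= ?fset1U1 //.
have -> : dominion (restrict T (fset1U_neq0 a B)) a = [fset b in B | dom T a b].
  apply/fsetP=> b; rewrite mem_dominion /= in_fset1U !inE /=.
  by case: eqVneq => //= ->; rewrite dom_irr andbF.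
split=> -[lt_Dk [b [bB dba cov]]]; split=> //; exists b; split=> //.
- by case/fset1UP: bB dba => // ->; rewrite /= dom_irr.
- by move=> d dB; apply: cov; rewrite in_fset1U dB orbT.
- by rewrite /= in_fset1U bB orbT.
by move=> d /fset1UP[->|]; [rewrite /= dom_irr | apply: cov].
Qed.

(* Y collects the earlier members of the chain, x is the current one. *)
Lemma covering_chain T B C Y x :
  (forall a, a \in C -> a \notin B -> exists b, covers T B a b) ->
  (forall a, a \in B -> a \notin C -> exists b, covers T C a b) ->
  x \in B ->
  (forall y, y \in Y -> dom T x y) ->
  (forall y, y \in Y -> y \notin B -> exists2 z, z \in x |` Y & covers T B y z) ->
  (forall y, y \in Y -> y \notin C -> exists2 z, z \in x |` Y & covers T C y z) ->
  exists z, [/\ z \in B `&` C, forall y, y \in x |` Y -> y = z \/ dom T z y &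
    forall d, d \in B `&` C -> dom T x d -> dom T z d].
Proof.
(* The measure drops when [x] joins [Y]: [x] lies in [B] and, since it dominates every member of
   [Y], outside [Y]. The sets [B] and [C] are generalized because they swap roles at each step. *)
have [n] := ubnP #|` (B `|` C) `\` Y|.
elim: n => // n IHn in B C Y x *; rewrite ltnS => leYn covB covC xB xY YB YC.
have [xC|xC] := boolP (x \in C).
  exists x; split=> // [|y]; first by rewrite in_fsetI xB.
  by case/fset1UP; [left|right; apply: xY].
have [x' [x'C dx'x cov']] := covC x xB xC.
have x'Y y : y \in Y -> dom T x' y.
  move=> yY; have [yC|yC] := boolP (y \in C); first exact: cov' (xY y yY).
  (* Suppose [y] outside [C] dominates [x']. The cover [z] of [y] in [C] then dominates [x'] too.
     But [z] is a chain member other than [x], so [x] dominates it, and hence so does [x']: a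
     contradiction. *)
  apply: (dom_neq (a := y)); first by apply: contraNneq yC => ->.
  apply/negP=> dyx'; have [z zY [zC _ covz]] := YC y yY yC.
  have /dom_asym/negP[] : dom T z x' by apply: covz.
  apply: (cov' z zC); case/fset1UP: zY zC => [->|/xY //].
  by rewrite (negPf xC).
have xnY : x \notin Y by apply/negP=> /xY; rewrite dom_irr.
have [|//|//|//|y|y|y|z [zBC zY zx']] := IHn C B (x |` Y) x'.
- apply: leq_trans leYn; apply: fproper_ltn_card.
  rewrite fproperE; apply/andP; split.
    apply/fsubsetP=> y.
    rewrite !in_fsetD in_fset1U negb_or => /andP[/andP[_ ->]].
    by rewrite fsetUC.
  apply/fsubsetPn; exists x; first by rewrite in_fsetD xnY in_fsetU xB.
  by rewrite in_fsetD fset1U1.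
- by case/fset1UP=> [->|/x'Y].
- move=> /fset1UP[->|yY] yC; first by exists x'; rewrite ?fset1U1.
  by have [z zY cz] := YC y yY yC; exists z; rewrite // in_fset1U zY orbT.
- move=> /fset1UP[->|yY] yB; first by rewrite xB in yB.
  by have [z zY cz] := YB y yY yB; exists z; rewrite // in_fset1U zY orbT.
(* Inside the intersection [x'] dominates whatever [x] does, so the property of [z] passes from [x']
   back to [x]. *)
exists z; rewrite fsetIC; split=> // [y yY|d dCB dxd].
  by apply: zY; rewrite in_fset1U yY orbT.
by apply: zx' => //; apply: cov' dxd; case/fsetIP: dCB.
Qed.

(** The chain starts at a cover [b] of [a] in [B], and its last member is the required cover. *)
Lemma covers_fsetI T B C a :
  (forall b, b \in C -> b \notin B -> exists c, covers T B b c) ->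
  (forall b, b \in B -> b \notin C -> exists c, covers T C b c) ->
  a \notin B -> (exists b, covers T B a b) -> exists b, covers T (B `&` C) a b.
Proof.
move=> covB covC aB [b [bB dba cov]].
have in0 (P : X -> Prop) y : y \in fset0 -> P y by rewrite in_fset0.
have [z [zBC zb zd]] :=
  covering_chain covB covC bB (@in0 _) (@in0 _) (@in0 _).
have zB : z \in B by case/fsetIP: zBC.
exists z; split=> // [|d dBC dad].
  apply: (dom_neq (a := a)); first by apply: contraNneq aB => ->.
  (* If [a] dominated [z], so would its cover [b], whereas [z] equals or dominates [b]. *)
  apply/negP=> daz; have dbz := cov z zB daz.
  case: (zb b) => [|eq_bz|/dom_asym]; first exact: fset1U1.
    by rewrite eq_bz dom_irr in dbz.
  by rewrite dbz.
by apply: zd => //; apply: cov dad; case/fsetIP: dBC.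
Qed.

End Covering.

Theorem theorem3 (X : choiceType) (k : nat) (T : tournament X)
    (B C : {fset X}) :
  B \in stable_sets (sol_Mk k) T ->
  C \in stable_sets (sol_Mk k) T ->
  B `&` C \in stable_sets (sol_Mk k) T.
Proof.
case: k => [|k] /stable_setsP[sB stB] /stable_setsP[sC stC];
  have sBC : B `&` C `<=` alts T by apply: fsubset_trans (fsubsetIl _ _) sB.
  by apply/stable_setsP; split=> // a _ _; rewrite sol_M0.
apply/stable_setsP; split=> // a aT aBC; apply/notin_sol_restrict => //.
have covB b : b \in alts T -> b \notin B -> exists c, covers T B b c.
  by move=> bT bB; case/notin_sol_restrict: (stB b bT bB).
have covC b : b \in alts T -> b \notin C -> exists c, covers T C b c.
  by move=> bT bC; case/notin_sol_restrict: (stC b bT bC).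
have covB' b (bC : b \in C) := covB b (fsubsetP sC b bC).
have covC' b (bB : b \in B) := covC b (fsubsetP sB b bB).
(* Passing to the intersection can only shrink the set of dominated alternatives, so the size
   condition is inherited from either stable set. *)
have small D : B `&` C `<=` D -> #|` [fset b in D | dom T a b]| < k ->
    #|` [fset b in B `&` C | dom T a b]| < k.
  move=> /fsubsetP sD; apply: leq_ltn_trans; apply: fsubset_leq_card.
  by apply/fsubsetP=> b; rewrite !inE /= => /andP[bBC ->]; rewrite andbT sD ?inE.
move: aBC; rewrite in_fsetI negb_and => /orP[aB|aC].
  have /(notin_sol_restrict _ _ aB)[lt_k ex_b] := stB a aT aB.
  by split; [apply: small lt_k; apply: fsubsetIl | apply: covers_fsetI].
have /(notin_sol_restrict _ _ aC)[lt_k ex_b] := stC a aT aC.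
split; first by apply: small lt_k; apply: fsubsetIr.
by rewrite fsetIC; apply: covers_fsetI.
Qed.
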